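(* Let $M$ be a p.f.d. persistence module and let $t\le u\in\mathbb R$. Then $$D^{\twoheadrightarrow}(M)_{t,u}=\left\{(i,j)\in\mathbb N^2\mid j\le\operatorname{rank}M_{t,u},\ i=j+\max\{\operatorname{rank}M_{s,t}-\operatorname{rank}M_{s,u}\mid s<t,\ \operatorname{rank}M_{s,u}<j\}\right\},$$ $$D^{\hookrightarrow}(M)_{t,u}=\left\{(i,j)\in\mathbb N^2\mid i\le\operatorname{rank}M_{t,u},\ j=i+\max\{\operatorname{rank}M_{u,v}-\operatorname{rank}M_{t,v}\mid v>u,\ \operatorname{rank}M_{t,v}<i\}\right\},$$ where the maximum over an empty set is taken to be $0$.
   Context: $\mathbb N=\{1,2,3,\dots\}$. Fix a field $K$. A pointwise finite dimensional (p.f.d.) persistence module is a functor $M$ from the poset category $\mathbf R$ of real numbers to finite dimensional $K$-vector spaces, with internal maps $M_{s,t}:M_s\to M_t$ for $s\le t$. An interval is a non-empty set $I\subseteq\mathbb R$ such that $a,c\in I$ and $a<b<c$ imply $b\in I$. $\mathcal B(M)$ is the barcode of $M$: the unique multiset of intervals, represented as a set of pairs $(I,n)$ with $n\in\mathbb N$ where the indices $n$ of each $I$ form a prefix of $\mathbb N$, such that $M\cong\bigoplus_{I\in\mathcal B(M)}K^I$; here $K^I$ is $K$ at indices in $I$, $0$ elsewhere, with identity internal maps between indices in $I$. An element $(I,n)$ is usually written $I$. A matching is a partial injective function, viewed as a relation; matchings are composed as relations. For $t\in\mathbb R$ let $E(\mathcal B(M))_t=\{I\in\mathcal B(M)\mid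 t\in I\}$, and for $t\le u$ let $E(\mathcal B(M))_{t,u}=\{(I,I)\mid I\in\mathcal B(M),\ t,u\in I\}$, a matching $E(\mathcal B(M))_t\to E(\mathcal B(M))_u$. Definition of $D^{\twoheadrightarrow}(M)$: order intervals lexicographically, first by increasing lower bound, then (for intervals with the same lower bound) by decreasing upper bound; lower and upper bounds here distinguish open and closed ends (e.g. $[0,3]<[1,2]<(1,3]<(1,2]$), and copies of the same interval are ordered by index. Enumerating the intervals of $\mathcal B(M)$ containing $t$ in this order gives a bijection $g_t:E(\mathcal B(M))_t\to D^{\twoheadrightarrow}(M)_t:=\{1,2,\dots,\dim M_t\}$. Set $D^{\twoheadrightarrow}(M)_{t,u}:=g_u\circ E(\mathcal B(M))_{t,u}\circ g_t^{-1}$, i.e. the matching $\{1,\dots,\dim M_t\}\to\{1,\dots,\dim M_u\}$ corresponding under $g_t,g_u$ to $E(\mathcal B(M))_{t,u}$. Definition of $D^{\hookrightarrow}(M)$: the same construction with intervals ordered lexicographically first by decreasing upper bound, then by increasing lower bound (copies again ordered by index). *)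

(* Defs.v *)
From HB Require Import structures.
From mathcomp Require Import all_boot all_order all_algebra finmap.
From mathcomp Require Import all_classical all_reals.
From mathcomp Require Import normedtype.

Set Implicit Arguments.
Unset Strict Implicit.
Unset Printing Implicit Defensive.
Import Order.TTheory GRing.Theory Num.Theory.

Local Open Scope classical_set_scope.
Local Open Scope ring_scope.

(* Pointwise finite dimensional persistence modules: functors from (R, <=) to
   finite dimensional K-vector spaces. *)
Record persmod (R : realType) (K : fieldType) := Persmod {
  pm_space :> R -> vectType K;
  pm_map : forall s t : R, s <= t -> 'Hom(pm_space s, pm_space t);
  pm_map_id : forall (t : R) (tt : t <= t), pm_map tt = \1%VF;
  pm_map_comp : forall (s t u : R) (st : s <= t) (tu : t <= u) (su : s <= u),
    pm_map su = (pm_map tu \o pm_map st)%VF }.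

Arguments pm_map {R K} M {s t} st : rename.

Definition pm_rank (R : realType) (K : fieldType) (M : persmod R K)
  (s t : R) (st : s <= t) : nat := \dim (limg (pm_map M st)).

Arguments pm_rank {R K} M {s t} st.

(* Non-empty convex subsets of R are represented by the i : interval R with
   neitv i. The bounds i.1, i.2 : itv_bound R are ordered by the library so
   that [x is below ]x as a lower bound, and x[ is below x] as an upper one. *)
Lemma convex_itv (R : realType) (X : set R) :
  X !=set0 /\ is_interval X <-> exists! i : interval R, neitv i /\ [set` i] = X.
Proof.
split=> [[X0 Xi]|[i [[i0 <-] _]]].
  have XE : [set` Rhull X] = X by rewrite [RHS](is_intervalP X).1.
  exists (Rhull X); split=> [|j [j0 jX]]; first by rewrite /neitv XE; split => //; apply/set0P.
  by rewrite -jX set_itvK.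
by split; [exact/set0P | exact: interval_is_interval].
Qed.

(* The interval module K^I: its space at t is 'rV[K]_1 or 'rV[K]_0 according
   to whether t \in I, and const_mx 1 is 1%:M in the 1 x 1 case. *)
Section IntervalModule.
Variables (R : realType) (K : fieldType) (I : interval R).

Definition itv_space (t : R) : vectType K := 'rV[K]_(t \in I).

Definition itv_map (s t : R) (st : s <= t) : 'Hom(itv_space s, itv_space t) :=
  linfun (mulmxr (const_mx 1 : 'M[K]_(s \in I, t \in I))).

Fact itv_map_id (t : R) (tt : t <= t) : itv_map tt = \1%VF.
Proof.
apply/lfunP => x; rewrite lfunE id_lfunE /=; move: x.
rewrite /itv_space; case: (t \in I) => /= x.
  by rewrite (_ : const_mx 1 = 1%:M) ?mulmx1 //; apply/matrixP => i j; rewrite !ord1 !mxE.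
by apply/matrixP => i [].
Qed.

Fact itv_map_comp (s t u : R) (st : s <= t) (tu : t <= u) (su : s <= u) :
  itv_map su = (itv_map tu \o itv_map st)%VF.
Proof.
have stuI : s \in I -> u \in I -> t \in I.
  by move=> sI uI; apply: (@interval_is_interval _ I s u) => //; rewrite st.
have cE : const_mx 1 = (const_mx 1 : 'M[K]_(s \in I, t \in I)) *m
    (const_mx 1 : 'M[K]_(t \in I, u \in I)) :> 'M[K]_(s \in I, u \in I).
  move: stuI; case: (s \in I) => [|_]; last by apply/matrixP => -[].
  case: (u \in I) => [|_]; last by apply/matrixP => i [].
  move=> -> //; apply/matrixP => i j.
  by rewrite !mxE big_ord1 !mxE mulr1.
by apply/lfunP => x; rewrite comp_lfunE !lfunE /= cE mulmxA.
Qed.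

Definition itv_mod : persmod R K := Persmod itv_map_id itv_map_comp.

End IntervalModule.

(* M is isomorphic to the direct sum of the N i: phi t identifies M t with the
   space of finitely supported families in the product of the N i t. *)
Definition iso_dsum (R : realType) (K : fieldType) (T : Type)
    (M : persmod R K) (N : T -> persmod R K) : Prop :=
  exists phi : forall (t : R) (i : T), 'Hom(M t, N i t),
  [/\ forall (t : R) (x : M t), finite_set [set i | phi t i x != 0],
      forall (t : R) (y : forall i, N i t), finite_set [set i | y i != 0] ->
        exists! x : M t, forall i, phi t i x = y i
    & forall (s t : R) (st : s <= t) (x : M s) (i : T),
        phi t i (pm_map M st x) = pm_map (N i) st (phi s i x)].

(* A pair (I, n) stands for the n-th copy of I, n >= 1. *)
Notation bar R := (interval R * nat)%type.

Definition multiset_rep (R : realType) (B : set (bar R)) : Prop :=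
  forall (I : interval R) (n : nat), B (I, n) ->
    [/\ neitv I, (0 < n)%N & forall m : nat, (0 < m <= n)%N -> B (I, m)].

Definition is_barcode (R : realType) (K : fieldType) (M : persmod R K)
    (B : set (bar R)) : Prop :=
  multiset_rep B /\ iso_dsum M (fun b : B => itv_mod K (val b).1).

Section Diagrams.
Variables (R : realType) (B : set (bar R)).

Definition bars_at (t : R) : set (bar R) := [set b | B b /\ t \in b.1].

Definition bars_match (t u : R) : set (bar R * bar R) :=
  [set p | [/\ p.1 = p.2, B p.1, t \in p.1.1 & u \in p.1.1]].

Definition le_epi : rel (bar R) := fun a b =>
  (a.1.1 < b.1.1)%O || (a.1.1 == b.1.1) &&
  ((b.1.2 < a.1.2)%O || (b.1.2 == a.1.2) && (a.2 <= b.2)%N).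

Definition le_mono : rel (bar R) := fun a b =>
  (b.1.2 < a.1.2)%O || (b.1.2 == a.1.2) &&
  ((a.1.1 < b.1.1)%O || (a.1.1 == b.1.1) && (a.2 <= b.2)%N).

(* The 1-based position of b among the bars at t; bars_at t is finite whenever
   B is the barcode of a persmod (fset_set of an infinite set is empty). *)
Definition bar_pos (le : rel (bar R)) (t : R) (b : bar R) : nat :=
  (index b (sort le (fset_set (bars_at t)))).+1.

(* The relation g_u o E_{t,u} o g_t^-1, with g_t := bar_pos le t on bars_at t
   and E_{t,u} := bars_match t u. *)
Definition diag (le : rel (bar R)) (t u : R) : set (nat * nat) :=
  [set (bar_pos le t p.1, bar_pos le u p.2) | p in bars_match t u].

Definition D_epi : R -> R -> set (nat * nat) := diag le_epi.
Definition D_mono : R -> R -> set (nat * nat) := diag le_mono.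

End Diagrams.

Definition max0 (A : set nat) : nat :=
  xget 0%N [set m | A m /\ forall a, A a -> (a <= m)%N].

Lemma max0_0 : max0 set0 = 0%N.
Proof. by rewrite /max0 xgetPN // => m []. Qed.

Lemma max0_bounded (A : set nat) (n : nat) :
  A !=set0 -> (forall a, A a -> (a <= n)%N) ->
  A (max0 A) /\ forall a, A a -> (a <= max0 A)%N.
Proof.
move=> [a Aa] An; have ex : exists m, `[< A m >] by exists a; apply/asboolP.
have ub m : `[< A m >] -> (m <= n)%N by move=> /asboolP /An.
rewrite /max0; case: (ex_maxnP ex ub) => m /asboolP Am mM.
apply: (@xgetPex _ 0%N [set m | A m /\ forall a, A a -> (a <= m)%N]).
by exists m; split=> // b Ab; apply: mM; apply/asboolP.
Qed.

(* Main.v *)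
(* The basis vectors of the interval summands show that rank M_{s,t} counts the
   bars containing both s and t. Let b be a bar containing t and u, at position
   j at u. In the order by increasing lower bound, every bar at u preceding b
   contains t, so the position of b at t exceeds j by the number of bars
   preceding b that contain t but not u. For s < t, fewer than j bars contain s
   and u exactly when s lies below b, and then the bars containing s and t but
   not u all precede b; conversely, if some bar containing t but not u precedes
   b, the last such bar has a strictly smaller lower bound than b, and an s
   between the two lower bounds counts all of them. The second order behaves in
   the same way with time reversed and t, u exchanged. *)
Require Import Defs.
From HB Require Import structures.
From mathcomp Require Import all_boot all_order all_algebra finmap.
From mathcomp Require Import all_classical all_reals.
From mathcomp Require Import normedtype.

Import Order.TTheory GRing.Theory Num.Theory.
Local Open Scope classical_set_scope.
Local Open Scope ring_scope.

(** * Positions in sorted finite sets and the matching they induce *)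

Lemma index_sorted_count (T : eqType) (le : rel T) (s : seq T) (b : T) :
  reflexive le -> transitive le -> antisymmetric le ->
  sorted le s -> uniq s -> b \in s ->
  (index b s).+1 = count (le^~ b) s.
Proof.
move=> refl trans anti; elim: s => //= x s IH xs /andP[xNs us].
rewrite in_cons eq_sym; have /allP xle := order_path_min trans xs.
have [<- _|xb /= bs] := eqVneq x b; last first.
  by rewrite IH ?(path_sorted xs) // xle.
rewrite refl add1n; congr _.+1; apply/esym/eqP; rewrite -leqn0 leqNgt -has_count.
apply: contra xNs => /hasP[y ys yb].
by rewrite (anti x y) ?xle ?yb.
Qed.

Section PrefixMatching.
Variables (T : choiceType) (le : rel T).
Hypotheses (le_tot : total le) (le_tr : transitive le) (le_anti : antisymmetric le).
Local Open Scope fset_scope.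

Let le_refl : reflexive le.
Proof. by move=> x; have /orP[] := le_tot x x. Qed.

Definition position (X : {fset T}) (b : T) : nat := (index b (sort le X)).+1.

Lemma position_card (X : {fset T}) (b : T) : b \in X ->
  position X b = #|` [fset a in X | le a b]|.
Proof.
move=> bX; rewrite /position (index_sorted_count _ le) //; last 3 first.
- exact: sort_sorted.
- by rewrite sort_uniq fset_uniq.
- by rewrite mem_sort.
rewrite count_sort -size_filter; apply/perm_size/uniq_perm.
- by rewrite filter_uniq ?fset_uniq.
- exact: fset_uniq.
- by move=> a; rewrite mem_filter !inE /= andbC.
Qed.

(** Despite the name this is surjectivity: it recovers an element from its number and yields the
    last element of a finite set. *)
Lemma position_inj (X : {fset T}) (j : nat) : (0 < j <= #|` X|)%N ->
  exists2 b, b \in X & position X b = j.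
Proof.
case: j => // j /= jX; have [x0 _] : exists x, x \in X.
  by apply/fset0Pn; rewrite -cardfs_gt0 (leq_trans _ jX).
exists (nth x0 (sort le X) j); first by rewrite -(mem_sort le) mem_nth // size_sort.
by rewrite /position index_uniq ?size_sort // sort_uniq fset_uniq.
Qed.

(* [bd s t] reads: s lies beyond t, on the side where the bars that come first
   in the order [le] extend the furthest. *)
Variables (S : Type) (E : S -> {fset T}) (bd sbd : S -> S -> Prop).
Hypotheses (sbdW : forall s t, sbd s t -> bd s t)
  (bd_trans : forall s t u, bd s t -> bd t u -> bd s u)
  (E_convex : forall s t u a, bd s t -> bd t u -> a \in E s -> a \in E u -> a \in E t)
  (E_down : forall s t a b, bd s t -> a \in E t -> le a b -> b \in E s -> a \in E s)
  (E_sep : forall t u a b, bd t u -> a \in E t -> a \notin E u ->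
     b \in E t -> b \in E u -> le a b -> exists s, [/\ sbd s t, a \in E s & b \notin E s]).

(** Otherwise [le b a] by totality, and [E_down] would put [b] in [E s]. So the part of [E t] alive
    at [s] is an initial segment of [E t]. *)
Let E_lt s t a b : bd s t -> a \in E s -> b \in E t -> b \notin E s -> le a b.
Proof.
move=> st aEs bEt bNs; have /orP[//|ba] := le_tot a b.
by rewrite (E_down s t b a) in bNs.
Qed.

(** The set under the maximum in the rank formula, with ranks replaced by numbers of common
    elements. *)
Definition excess (t u : S) (j : nat) : set nat := [set d | exists s,
  [/\ sbd s t, (#|` E s `&` E u| < j)%N &
      d = (#|` E s `&` E t| - #|` E s `&` E u|)%N]].

(** By convexity an element of [E s] and [E u] lies in [E t], so the subtraction is a true
    difference of sizes. *)
Lemma excessE s t u : bd s t -> bd t u ->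
  (#|` E s `&` E t| - #|` E s `&` E u|)%N = #|` (E s `&` E t) `\` E u|.
Proof.
move=> st tu; rewrite cardfsD; congr (_ - #|` _|)%N; apply/fsetP => a.
rewrite !inE; apply/andP/andP => [[aEs aEu]|[/andP[]]//].
by rewrite aEs (E_convex s t u a).
Qed.

(** By [E_down] the predecessors of [b] in [E u] all lie in [E t], so the surplus at [t] is the set
    [X] below. Its size bounds the excess set ([ub]) and, when positive, belongs to it ([att]). *)
Lemma position_shift t u b : bd t u -> b \in E t -> b \in E u ->
  position (E t) b = (position (E u) b + max0 (excess t u (position (E u) b)))%N.
Proof.
move=> tu bEt bEu; rewrite !position_card //.
set j := #|` [fset a in E u | le a b]|; pose X := [fset a in E t `\` E u | le a b].
have -> : #|` [fset a in E t | le a b]| = (j + #|` X|)%N.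
  rewrite -cardfsUI (_ : _ `&` X = fset0) ?cardfs0 ?addn0; last first.
    by apply/fsetP => a; rewrite !inE; case: (a \in E u); rewrite ?andbF.
  congr #|` _|; apply/fsetP => a; rewrite !inE /=.
  have := E_down t u a b tu; case: (le a b); rewrite ?andbF ?andbT //.
  by case: (a \in E u) => //= ->.
congr addn.
have ub d : excess t u j d -> (d <= #|` X|)%N.
  move=> [s [st lej ->]]; have stb := sbdW _ _ st; rewrite excessE //.
  (* If [b] were in [E s], so would be its [j] predecessors in [E u], against the strict bound. *)
  have bNs : b \notin E s.
    apply/negP => bEs; move: lej; rewrite ltnNge => /negP; apply.
    apply/fsubset_leq_card/fsubsetP => a; rewrite !inE /= => /andP[aEu ab].
    by rewrite aEu (E_down s u a b) //; apply: bd_trans tu.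
  apply/fsubset_leq_card/fsubsetP => a; rewrite !inE => /and3P[-> aEs ->] /=.
  exact: (E_lt s t).
have att : (0 < #|` X|)%N -> excess t u j #|` X|.
  (* Take the last element [a] of [X]: if [s] separates it from [b], then [E_down] carries
     membership in [E s] from [a] to all of [X]. *)
  move=> X0; have [a aX apos] : exists2 a, a \in X & position X a = #|` X|.
    by apply: position_inj; rewrite X0 leqnn.
  have amax c : c \in X -> le c a.
    move=> cX; move: apos; rewrite position_card // => /eqP eqX.
    have : [fset c in X | le c a] == X.
      rewrite eqEfcard (eqP eqX) leqnn andbT; apply/fsubsetP => z.
      by rewrite !inE /= => /andP[].
    by move=> /eqP XE; move: cX; rewrite -XE !inE => /andP[].
  move: (aX); rewrite !inE /= => /andP[/andP[aNu aEt] ab].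
  have [s [st aEs bNs]] := E_sep t u a b tu aEt aNu bEt bEu ab.
  have stb := sbdW _ _ st.
  exists s; split=> //.
    (* The common elements of [E s] and [E u] precede [b] and differ from it, which leaves at most
       [j - 1]. *)
    apply: (@leq_ltn_trans #|` [fset a in E u | le a b] `\ b|).
      apply/fsubset_leq_card/fsubsetP => c; rewrite !inE /= => /andP[cEs cEu].
      rewrite cEu /=; apply/andP; split; first by apply: contraNneq bNs => <-.
      by apply: (E_lt s t) => //.
    by rewrite /j [X in (_ < X)%N](cardfsD1 b) !inE bEu le_refl.
  rewrite excessE //; congr #|` _|; apply/fsetP => c; rewrite !inE /=.
  apply/idP/idP => [/andP[/andP[cNu cEt] cb]|/and3P[cNu cEs cEt]].
    by rewrite cNu cEt andbT (E_down s t c a) // amax // !inE /= cNu cEt.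
  by rewrite cNu cEt (E_lt s t).
have [X0|X0] := posnP #|` X|; last first.
  have [/ub le1 /(_ _ (att X0)) le2] := max0_bounded (ex_intro _ _ (att X0)) ub.
  by apply/eqP; rewrite eqn_leq le1 le2.
(* For empty [X] the maximum is 0, either by [ub] or as the default of [max0] on the empty set. *)
rewrite X0; have [[d dD]|D0] := pselect (excess t u j !=set0).
  have [/ub] := max0_bounded (ex_intro _ d dD) ub.
  by rewrite X0 leqn0 => /eqP ->.
by move/set0P/negP/negPn/eqP: D0 => ->; rewrite max0_0.
Qed.

(** [E t] cuts out an initial segment of [E u], so membership amounts to comparing a position with
    the size of that segment. *)
Lemma position_le t u b : bd t u -> b \in E u ->
  (b \in E t) = (position (E u) b <= #|` E t `&` E u|)%N.
Proof.
move=> tu bEu; rewrite position_card //; apply/idP/idP => [bEt|].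
  apply/fsubset_leq_card/fsubsetP => a; rewrite !inE /= => /andP[aEu ab].
  by rewrite aEu (E_down t u a b).
apply: contraLR => bNt; rewrite -ltnNge.
rewrite [X in (_ < X)%N](cardfsD1 b) !inE bEu le_refl ltnS.
apply/fsubset_leq_card/fsubsetP => a; rewrite !inE /= => /andP[aEt aEu].
rewrite aEu (E_lt t u) // !andbT; by apply: contraNneq bNt => <-.
Qed.

(** The position at [u] determines the element, [position_le] decides whether it is alive at [t],
    and [position_shift] gives its position there. *)
Lemma prefix_matching t u : bd t u ->
  [set ij | exists b, [/\ b \in E t, b \in E u &
                          ij = (position (E t) b, position (E u) b)]] =
  [set ij | [/\ (0 < ij.1)%N, (0 < ij.2)%N, (ij.2 <= #|` E t `&` E u|)%N &
                ij.1 = (ij.2 + max0 (excess t u ij.2))%N]].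
Proof.
move=> tu; apply/seteqP; split=> [_ [b [bEt bEu ->]]|[i j]] /=.
  by split=> //; [rewrite -position_le | exact: position_shift].
move=> [_ j0 jle ->].
have [b bEu bj] : exists2 b, b \in E u & position (E u) b = j.
  apply: position_inj; rewrite j0 (leq_trans jle) //.
  by apply/fsubset_leq_card/fsubsetP => a; rewrite !inE => /andP[].
have bEt : b \in E t by rewrite (position_le _ u) ?bj.
by exists b; split=> //; rewrite (position_shift t u) // bj.
Qed.

End PrefixMatching.

Arguments position {T}.
Arguments excess {T S}.

(** * Coordinates in interval modules, and freeness by duality *)

Lemma itv_mapE (R : realType) (K : fieldType) (I : interval R) (s t : R)
    (st : s <= t) (x : 'rV[K]_(s \in I)) :
  itv_map K I st x = (\sum_j x 0 j) *: const_mx 1 :> 'rV[K]_(t \in I).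
Proof.
rewrite lfunE /=; apply/matrixP => i j; rewrite !mxE mulr1 ord1.
by apply: eq_bigr => k _; rewrite mxE mulr1.
Qed.

Lemma sum_const_row (K : fieldType) (b : bool) (a : K) :
  \sum_j (const_mx a : 'rV[K]_b) 0 j = if b then a else 0.
Proof.
by case: b; rewrite ?big_ord0 // big_ord1 mxE.
Qed.

(** Summing entries treats rows of length 0 and 1 alike; as a coordinate, the sum loses nothing. *)
Lemma row_sumE (K : fieldType) (b : bool) (x : 'rV[K]_b) :
  x = const_mx (\sum_j x 0 j).
Proof.
case: b x => x; apply/matrixP => i [] //= j jlt.
by rewrite mxE big_ord1 !ord1; congr (x _ _); apply/val_inj; case: j jlt.
Qed.

Lemma scalar0 (K : fieldType) (V : lmodType K) (f : V -> K) :
  scalar f -> f 0 = 0.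
Proof.
by move=> f_lin; rewrite -[X in f X](addNr 0) -scaleN1r f_lin mulN1r addNr.
Qed.

Lemma scalar_sum (K : fieldType) (V : lmodType K) (f : V -> K) (J : Type)
    (r : seq J) (a : J -> K) (v : J -> V) : scalar f ->
  f (\sum_(i <- r) a i *: v i) = \sum_(i <- r) a i * f (v i).
Proof.
move=> f_lin; elim: r => [|i r IH]; last by rewrite !big_cons f_lin IH.
by rewrite !big_nil scalar0.
Qed.

(** Applying one dual functional to a vanishing combination isolates one coefficient. *)
Lemma free_dual (K : fieldType) (V : vectType K) (J : eqType) (r : seq J)
    (e : J -> V) (c : J -> V -> K) : uniq r -> (forall j, scalar (c j)) ->
  {in r &, forall i j, c j (e i) = (j == i)%:R} -> free (map e r).
Proof.
move=> r_uniq c_lin c_e; case: r => [|x0 r] in r_uniq c_e *; first exact: nil_free.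
set r' := x0 :: r in r_uniq c_e *.
apply/(@freeP _ _ _ (in_tuple (map e r'))) => k k0 i.
have lt_r (j : 'I_(size (map e r'))) : (j < size r')%N by rewrite -(size_map e r').
have eE (j : 'I_(size (map e r'))) : (in_tuple (map e r'))`_j = e (nth x0 r' j).
  by rewrite (nth_map x0) ?lt_r.
have r_nth (j : 'I_(size (map e r'))) : nth x0 r' j \in r' by rewrite mem_nth ?lt_r.
have := congr1 (c (nth x0 r' i)) k0.
rewrite scalar0 // scalar_sum // (bigD1 i) // eE c_e // eqxx mulr1.
rewrite big1 => [|j /= ji]; [by rewrite /= addr0 | rewrite eE c_e //].
by rewrite nth_uniq ?lt_r // eq_sym (inj_eq val_inj) (negbTE ji) mulr0.
Qed.

(** * Bases adapted to a barcode, and ranks as numbers of bars *)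

Section Rank.
Variables (R : realType) (K : fieldType) (M : persmod R K) (B : set (bar R)).
Hypothesis BM : is_barcode M B.

(** Dual families transported from the interval summands through the isomorphism. They are defined
    for every [b], which keeps membership proofs out of the types. *)
Lemma barcode_basis : exists (e : forall t, bar R -> M t)
    (c : forall t, bar R -> M t -> K),
  [/\ forall t b, scalar (c t b),
      forall t b b', B b' -> t \in b'.1 -> c t b' (e t b) = (b' == b)%:R,
      forall t (x y : M t),
        (forall b, B b -> t \in b.1 -> c t b x = c t b y) -> x = y
    & forall s t (st : s <= t) x b, B b -> t \in b.1 ->
        c t b (pm_map M st x) = if s \in b.1 then c s b x else 0].
Proof.
have [_ [phi [phi_fin phi_bij phi_nat]]] := BM.
pose coord t (i : B) (x : M t) : K := \sum_j (phi t i x : 'rV[K]__) 0 j.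
pose c t b x := if insub b is Some i then coord t i x else 0.
have cE t b (Bb : B b) x : c t b x = coord t (SigSub (mem_set Bb)) x.
  rewrite /c; case: insubP => [i _ ib|]; last by rewrite mem_set.
  by congr coord; apply: val_inj.
have exE t b : exists x : M t, forall b', B b' -> t \in b'.1 -> c t b' x = (b' == b)%:R.
  (* The indicator family of [b] has at most one non-zero member; its preimage becomes [e t b]. *)
  pose y (i : B) : itv_mod K (val i).1 t := const_mx (val i == b)%:R.
  have yfin : finite_set [set i | y i != 0].
    apply: (@sub_finite_set _ _ (val @^-1` [set b])).
      move=> i /=; have [//|ib] := eqVneq (val i) b.
      by rewrite /y (negbTE ib) eqxx.
    by apply: finite_preimage; [move=> i j _ _; exact: val_inj | exact: finite_set1].
  have [x [xy _]] := phi_bij t y yfin.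
  by exists x => b' Bb' tb'; rewrite (cE t b' Bb') /coord xy sum_const_row /= tb'.
exists (fun t b => projT1 (cid (exE t b))), c; split.
- move=> t b a x y; rewrite /c; case: insub => [i|]; last by rewrite mulr0 addr0.
  rewrite /coord linearP mulr_sumr -big_split.
  by apply: eq_bigr => j _; rewrite !mxE.
- by move=> t b b'; case: cid => x /= xP; exact: xP.
(* Both vectors equal the unique preimage [z] of the components of [x]. *)
- move=> t x y xy; have [z [_ zu]] := phi_bij t (fun i => phi t i x) (phi_fin t x).
  rewrite -(zu x) // (zu y) // => i.
  have := xy (val i) (set_mem (valP i)); rewrite !(cE _ _ (set_mem (valP i))).
  have -> : SigSub (mem_set (set_mem (valP i))) = i by exact: val_inj.
  rewrite /coord; set I := (val i).1; move: (phi t i x) (phi t i y); rewrite /= -/I.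
  rewrite /itv_space; case: (t \in I) => v w vw.
    by rewrite (row_sumE _ _ v) (row_sumE _ _ w) vw.
  by apply/matrixP => ? [].
- move=> s t st x b Bb tb; rewrite !(cE _ _ Bb) /coord phi_nat itv_mapE.
  rewrite [X in \sum_j (X : 'rV[K]__) 0 j](_ : _ = const_mx (\sum_j (phi s (SigSub (mem_set Bb)) x : 'rV[K]__) 0 j)); last first.
    by rewrite scalemx_const mulr1.
  rewrite sum_const_row tb; move: (phi s (SigSub (mem_set Bb)) x).
  rewrite /= /itv_space.
  by case: (s \in b.1) => v //; rewrite big_ord0.
Qed.

(** Infinitely many bars would give a free family larger than the dimension of [M t]. *)
Lemma finite_bars_at (t : R) : finite_set (bars_at B t).
Proof.
have [e [c [c_lin c_e _ _]]] := barcode_basis.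
apply: contrapT => /(infinite_set_fset (\dim {:M t}).+1)[F FB].
apply/negP; rewrite -ltnNge ltnS.
rewrite -(size_map (e t)) -(eqP (free_dual _ _ _ _ (e t) (c t) (fset_uniq F) _ _)) //.
  exact/dimvS/subvf.
by move=> b b' /FB[Bb tb] /FB[Bb' tb']; exact: c_e.
Qed.

Definition fbars (t : R) : {fset bar R} := fset_set (bars_at B t).

Lemma mem_fbars (t : R) (b : bar R) : reflect (B b /\ t \in b.1) (b \in fbars t).
Proof. by rewrite /fbars in_fset_set; [exact: asboolP | exact: finite_bars_at]. Qed.

(** The vectors [e t b], for bars [b] containing [s] and [t], form a basis of the image: they are
    free by duality, are the images of the [e s b], and span because coordinates of an image vanish
    at bars missing [s]. *)
Lemma pm_rankE (s t : R) (st : s <= t) :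
  pm_rank M st = #|` fbars s `&` fbars t|%fset.
Proof.
have [e [c [c_lin c_e c_inj c_map]]] := barcode_basis.
set F := (_ `&` _)%fset.
have FP b : reflect [/\ B b, s \in b.1 & t \in b.1] (b \in F).
  rewrite in_fsetI; apply: (iffP andP) => [[/mem_fbars[Bb sb] /mem_fbars[_ tb]]|[Bb sb tb]].
    by [].
  by split; apply/mem_fbars.
have eF b : b \in F -> pm_map M st (e s b) = e t b.
  move=> /FP[Bb sb tb]; apply: c_inj => b' Bb' tb'.
  rewrite c_map // [RHS]c_e //; case: ifPn => [sb'|]; first by rewrite c_e.
  by have [->|//] := eqVneq b' b; rewrite sb.
have Ffree : free (map (e t) F).
  apply: free_dual (c t) _ _ _ => //; first exact: fset_uniq.
  by move=> b b' /FP[Bb _ tb] /FP[Bb' _ tb']; exact: c_e.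
rewrite /pm_rank -(size_map (e t) F) -(eqP Ffree); congr (\dim _).
apply/eqP; rewrite eqEsubv; apply/andP; split; last first.
  apply/span_subvP => _ /mapP[b bF ->]; rewrite -eF //.
  by apply: memv_img; exact: memvf.
apply/subvP => _ /memv_imgP[x _ ->].
suff -> : pm_map M st x = \sum_(b <- F) c s b x *: e t b.
  rewrite big_seq; apply: memv_suml => b bF; apply/memvZ/memv_span.
  exact: map_f.
apply: c_inj => b Bb tb; rewrite c_map // (scalar_sum _ _ _ _ _ _ _ (c_lin t b)).
case: ifPn => sb.
  have bF : b \in F by exact/FP.
  rewrite (bigD1_seq b) ?fset_uniq //= c_e // eqxx mulr1 big1 ?addr0 // => b' b'b.
  by rewrite c_e // eq_sym (negbTE b'b) mulr0.
rewrite big_seq big1 // => b' /FP[_ sb' _]; rewrite c_e //.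
have [bb'|_] := eqVneq b b'; last by rewrite mulr0.
by rewrite bb' sb' in sb.
Qed.

End Rank.
Arguments fbars {R} B t.

(** * The two orders on bars *)

Section BarOrders.
Variable R : realType.
Implicit Types a b : bar R.

Lemma le_epi_total : total (@le_epi R).
Proof.
move=> a b; rewrite /le_epi.
by case: (ltgtP a.1.1 b.1.1) => //= _; case: (ltgtP a.1.2 b.1.2) => //= _; exact: leq_total.
Qed.

Lemma le_mono_total : total (@Defs.le_mono R).
Proof.
move=> a b; rewrite /Defs.le_mono.
by case: (ltgtP a.1.2 b.1.2) => //= _; case: (ltgtP a.1.1 b.1.1) => //= _; exact: leq_total.
Qed.

Lemma bar_eq a b : a.1.1 = b.1.1 -> a.1.2 = b.1.2 -> a.2 = b.2 -> a = b.
Proof. by move: a b => [[? ?] ?] [[? ?] ?] /= -> -> ->. Qed.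

Lemma le_epi_anti : antisymmetric (@le_epi R).
Proof.
move=> a b; rewrite /le_epi.
case: (ltgtP a.1.1 b.1.1) => //= e1; case: (ltgtP a.1.2 b.1.2) => //= e2.
by rewrite -eqn_leq => /eqP; exact: bar_eq.
Qed.

Lemma le_mono_anti : antisymmetric (@Defs.le_mono R).
Proof.
move=> a b; rewrite /Defs.le_mono.
case: (ltgtP a.1.2 b.1.2) => //= e2; case: (ltgtP a.1.1 b.1.1) => //= e1.
by rewrite -eqn_leq => /eqP; exact: bar_eq.
Qed.

Lemma le_epi_trans : transitive (@le_epi R).
Proof.
move=> b a c; rewrite /le_epi.
case: (ltgtP a.1.1 b.1.1) => //= [ab _|->].
  by case: (ltgtP b.1.1 c.1.1) => //= [bc _|<- _]; rewrite ?(lt_trans ab bc) ?ab.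
case: (ltgtP b.1.1 c.1.1) => //= _.
case: (ltgtP a.1.2 b.1.2) => //= [ba _|->].
  by case: (ltgtP b.1.2 c.1.2) => //= [cb _|<- _]; rewrite ?(lt_trans cb ba) ?ba.
by case: (ltgtP b.1.2 c.1.2) => //= _; exact: leq_trans.
Qed.

Lemma le_mono_trans : transitive (@Defs.le_mono R).
Proof.
move=> b a c; rewrite /Defs.le_mono.
case: (ltgtP a.1.2 b.1.2) => //= [ba _|->].
  by case: (ltgtP b.1.2 c.1.2) => //= [cb _|<- _]; rewrite ?(lt_trans cb ba) ?ba.
case: (ltgtP b.1.2 c.1.2) => //= _.
case: (ltgtP a.1.1 b.1.1) => //= [ab _|->].
  by case: (ltgtP b.1.1 c.1.1) => //= [bc _|<- _]; rewrite ?(lt_trans ab bc) ?ab.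
by case: (ltgtP b.1.1 c.1.1) => //= _; exact: leq_trans.
Qed.

Lemma mem_bar (b : bar R) (t : R) :
  (t \in b.1) = (b.1.1 <= BLeft t)%O && (BRight t <= b.1.2)%O.
Proof. by case: b => [[l r] n]; rewrite itv_boundlr. Qed.

Lemma mem_bar_between (b : bar R) (s t u : R) :
  s <= t -> t <= u -> s \in b.1 -> u \in b.1 -> t \in b.1.
Proof.
by move=> st tu sb ub; apply: (@interval_is_interval _ b.1 s u) => //; rewrite st.
Qed.

(** The order controls the lower bound of [a]; [t \in a.1] and [s <= t] control the upper one. *)
Lemma le_epi_down (s t : R) a b : s <= t -> t \in a.1 -> le_epi a b ->
  s \in b.1 -> s \in a.1.
Proof.
rewrite !mem_bar => st /andP[_ ta] ab /andP[bs _].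
apply/andP; split; last by apply: le_trans ta; rewrite bnd_simp.
by apply: le_trans bs; case/orP: ab => [/ltW//|/andP[/eqP->]].
Qed.

Lemma le_mono_down (s t : R) a b : t <= s -> t \in a.1 -> Defs.le_mono a b ->
  s \in b.1 -> s \in a.1.
Proof.
rewrite !mem_bar => ts /andP[at_ _] ab /andP[_ sb].
apply/andP; split; first by apply: le_trans at_ _; rewrite bnd_simp.
by apply: le_trans sb _; case/orP: ab => [/ltW//|/andP[/eqP->]].
Qed.

(** Since [a] ends before [u] and [b] does not, equal lower bounds would put [b] first. The lower
    bounds thus differ strictly and leave room for [s]. *)
Lemma le_epi_sep (t u : R) a b : t <= u -> t \in a.1 -> u \notin a.1 ->
  t \in b.1 -> u \in b.1 -> le_epi a b ->
  exists s : R, [/\ s < t, s \in a.1 & s \notin b.1].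
Proof.
rewrite !mem_bar negb_and => tu /andP[at_ ta] uNa /andP[bt _] /andP[_ ub] ab.
have {uNa} ua : (a.1.2 < BRight u)%O.
  rewrite ltNge; case/orP: uNa => // /negP[].
  by apply: le_trans at_ _; rewrite bnd_simp.
have {}ab : (a.1.1 < b.1.1)%O.
  case/orP: ab => // /andP[_ /orP[ba|/andP[/eqP ba _]]].
    by have := lt_trans (le_lt_trans ub ba) ua; rewrite ltxx.
  by have := le_lt_trans ub (eq_ind_r (fun x => (x < _)%O) ua ba); rewrite ltxx.
(* Bounds distinguish open from closed ends, so even two distinct bounds at the same real number
   enclose a point, namely that number. *)
pose s := miditv (Interval a.1.1 b.1.1).
have as_ : (a.1.1 <= BLeft s)%O by exact: (@miditv_ge_right _ (Interval a.1.1 b.1.1)).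
have sb : (BRight s <= b.1.1)%O by exact: (@miditv_le_left _ (Interval a.1.1 b.1.1)).
have st : s < t by have := le_trans sb bt; rewrite bnd_simp.
exists s; split=> //; rewrite mem_bar.
  by rewrite as_ (le_trans _ ta) // bnd_simp ltW.
by rewrite negb_and -ltNge -leBRight_ltBLeft sb.
Qed.

(** With time reversed, [a] starts after [u] and [b] does not, so equal upper bounds would put [b]
    first. *)
Lemma le_mono_sep (t u : R) a b : u <= t -> t \in a.1 -> u \notin a.1 ->
  t \in b.1 -> u \in b.1 -> Defs.le_mono a b ->
  exists s : R, [/\ t < s, s \in a.1 & s \notin b.1].
Proof.
rewrite !mem_bar negb_and => ut /andP[at_ ta] uNa /andP[_ tb] /andP[bu _] ab.
have {uNa} au : (BLeft u < a.1.1)%O.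
  rewrite ltNge; case/orP: uNa => // /negP[].
  by apply: le_trans ta; rewrite bnd_simp.
have {}ab : (b.1.2 < a.1.2)%O.
  case/orP: ab => // /andP[_ /orP[ab|/andP[/eqP ab _]]].
    by have := lt_trans au (lt_le_trans ab bu); rewrite ltxx.
  by have := lt_le_trans au (eq_ind_r (fun x => (x <= _)%O) bu ab); rewrite ltxx.
pose s := miditv (Interval b.1.2 a.1.2).
have bs : (b.1.2 <= BLeft s)%O by exact: (@miditv_ge_right _ (Interval b.1.2 a.1.2)).
have sa : (BRight s <= a.1.2)%O by exact: (@miditv_le_left _ (Interval b.1.2 a.1.2)).
have ts : t < s by have := le_trans tb bs; rewrite bnd_simp.
exists s; split=> //; rewrite mem_bar.
  by rewrite sa andbT (le_trans at_) // bnd_simp ltW.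
by rewrite negb_and -!ltNge ltBRight_leBLeft bs orbT.
Qed.

End BarOrders.

(** * The diagrams as matchings of positions, and the rank formulas *)

Lemma diagE (R : realType) (K : fieldType) (M : persmod R K) (B : set (bar R))
    (BM : is_barcode M B) (le : rel (bar R)) (t u : R) :
  diag B le t u = [set ij | exists b, [/\ b \in fbars B t, b \in fbars B u &
    ij = (position le (fbars B t) b, position le (fbars B u) b)]].
Proof.
apply/seteqP; split=> [_ [[b b'] [/= <- Bb tb ub] <-]|_ [b [bt bu ->]]] /=.
  by exists b; split=> //; apply/(mem_fbars _ _ _ _ BM).
move: bt bu => /(mem_fbars _ _ _ _ BM)[Bb tb] /(mem_fbars _ _ _ _ BM)[_ ub].
by exists (b, b).
Qed.

(* The subtractions of ranks are in nat; they are never truncated because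
   the map s -> u factors through s -> t, and t -> v through u -> v. *)
Theorem proposition5p3 (R : realType) (K : fieldType) (M : persmod R K)
    (B : set (bar R)) (BM : is_barcode M B) (t u : R) (tu : t <= u) :
  D_epi B t u =
    [set ij : nat * nat | [/\ (0 < ij.1)%N, (0 < ij.2)%N,
       (ij.2 <= pm_rank M tu)%N &
       ij.1 = (ij.2 + max0 [set d : nat |
         exists (s : R) (st : (s <= t)%R) (su : (s <= u)%R),
           [/\ (s < t)%R, (pm_rank M su < ij.2)%N &
               d = (pm_rank M st - pm_rank M su)%N]])%N]] /\
  D_mono B t u =
    [set ij : nat * nat | [/\ (0 < ij.1)%N, (0 < ij.2)%N,
       (ij.1 <= pm_rank M tu)%N &
       ij.2 = (ij.1 + max0 [set d : nat |
         exists (v : R) (uv : (u <= v)%R) (tv : (t <= v)%R),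
           [/\ (u < v)%R, (pm_rank M tv < ij.1)%N &
               d = (pm_rank M uv - pm_rank M tv)%N]])%N]].
Proof.
have FP := mem_fbars _ _ _ _ BM.
have rankE s v (sv : s <= v) := pm_rankE _ _ _ _ BM s v sv.
split.
- rewrite /D_epi (diagE _ _ _ _ BM).
  (* Bars that come first extend furthest towards smaller reals, so lying beyond means being
     smaller. *)
  rewrite (@prefix_matching _ _ (le_epi_total R) (le_epi_trans R) (le_epi_anti R) R
    (fbars B) (fun s t => s <= t) (fun s t => s < t)) //; first last.
  + move=> t' u' a b tu' /FP[Ba ta] aNu /FP[Bb tb] /FP[_ ub] ab.
    have uNa : u' \notin a.1 by apply: contra aNu => ua; apply/FP.
    have [s [st sa sNb]] := le_epi_sep _ _ _ _ _ tu' ta uNa tb ub ab.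
    by exists s; split=> //; [apply/FP | apply: contra sNb => /FP[]].
  + move=> s t' a b st /FP[Ba ta] ab /FP[_ sb]; apply/FP; split=> //.
    exact: le_epi_down st ta ab sb.
  + move=> s t' u' a st tu' /FP[Ba sa] /FP[_ ua]; apply/FP; split=> //.
    exact: mem_bar_between st tu' sa ua.
  + by move=> s t' u'; exact: le_trans.
  + by move=> s t'; exact: ltW.
  rewrite rankE; apply/seteqP.
  suff excE j : excess (fbars B) (fun s t => s < t) t u j = [set d : nat |
      exists (s : R) (st : (s <= t)%R) (su : (s <= u)%R),
        [/\ (s < t)%R, (pm_rank M su < j)%N & d = (pm_rank M st - pm_rank M su)%N]].
    by split=> -[i j] /=; rewrite excE.
  apply/seteqP; split=> d /= [s].
    move=> [st lej ->]; exists s, (ltW st), (le_trans (ltW st) tu).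
    by rewrite !rankE.
  by move=> [st [su [st' lej ->]]]; exists s; rewrite -!rankE.
- rewrite /D_mono (diagE _ _ _ _ BM).
  pose pos := position (@Defs.le_mono R).
  (* Time reversal exchanges [t] and [u], so the pairs come out swapped; the two inclusions are kept
     apart to swap them back at the end. *)
  have /seteqP[pos_rank rank_pos] : [set ij | exists b, [/\ b \in fbars B u, b \in fbars B t &
      ij = (pos (fbars B u) b, pos (fbars B t) b)]] =
    [set ij | [/\ (0 < ij.1)%N, (0 < ij.2)%N,
      (ij.2 <= #|` fbars B u `&` fbars B t|%fset)%N &
      ij.1 = (ij.2 + max0 (excess (fbars B) (fun s t => (t < s)%R) u t ij.2))%N]].
    apply: (@prefix_matching _ _ (le_mono_total R) (le_mono_trans R) (le_mono_anti R) R
      (fbars B) (fun s t => t <= s) (fun s t => t < s)) => //.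
    + by move=> s t'; exact: ltW.
    + by move=> s t' u' ts ut'; exact: le_trans ut' ts.
    + move=> s t' u' a ts ut' /FP[Ba sa] /FP[_ ua]; apply/FP; split=> //.
      exact: mem_bar_between ut' ts ua sa.
    + move=> s t' a b ts /FP[Ba ta] ab /FP[_ sb]; apply/FP; split=> //.
      exact: le_mono_down ts ta ab sb.
    + move=> t' u' a b ut' /FP[Ba ta] aNu /FP[Bb tb] /FP[_ ub] ab.
      have uNa : u' \notin a.1 by apply: contra aNu => ua; apply/FP.
      have [s [ts sa sNb]] := le_mono_sep _ _ _ _ _ ut' ta uNa tb ub ab.
      by exists s; split=> //; [apply/FP | apply: contra sNb => /FP[]].
  have excE i : excess (fbars B) (fun s t => t < s) u t i = [set d : nat |
      exists (v : R) (uv : (u <= v)%R) (tv : (t <= v)%R),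
        [/\ (u < v)%R, (pm_rank M tv < i)%N & d = (pm_rank M uv - pm_rank M tv)%N]].
    apply/seteqP; split=> d /= [v].
      move=> [uv lei ->]; exists v, (ltW uv), (le_trans tu (ltW uv)).
      (* [pm_rankE] puts the earlier time first, whereas [excess] puts [v] first. *)
      by rewrite !rankE ![(_ `&` fbars B v)%fset]fsetIC.
    move=> [uv [tv [uv' lei ->]]]; exists v.
    by rewrite ![(fbars B v `&` _)%fset]fsetIC -!rankE.
  apply/seteqP; split=> -[i j] /=.
    move=> [b [bt bu [-> ->]]].
    have := pos_rank (pos (fbars B u) b, pos (fbars B t) b).
    by rewrite /= excE fsetIC -rankE; case=> //; exists b.
  move=> [i0 j0 ler jE].
  have := rank_pos (j, i); rewrite /= excE fsetIC -rankE.
  by case=> // b [bu bt [-> ->]]; exists b.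
Qed.
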